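(* Let $f,g:[0,\infty)\to\mathbb{R}$ be continuous with $f(t)>0$ and $g(t)>0$ for all $t\ge 0$. Let $\gamma\ge 1$, $\alpha<0$ and $T>0$. Consider the optimal control problem $$\mathbf{(OC)}_T:\quad \min_{u\in L^2(0,T),\ y\in AC(0,T)}\ \int_0^T \tfrac12|u(t)|^2+|u(t)|+\gamma\,|y(t)|\,dt$$ subject to $$y(0)=\alpha,\qquad y'(t)=f(t)\,y(t)+g(t)\,u(t),\qquad y(T)=0.$$ Define $$F(t)=\exp\Big(\int_0^t f(s)\,ds\Big),\qquad H(t)=\int_0^t F(\tau)\,d\tau .$$ Then the state $y$ generated by a control $u$ (with $y(0)=\alpha$) is $$y(t)=F(t)\Big[\alpha+\int_0^t\frac{g(\tau)}{F(\tau)}\,u(\tau)\,d\tau\Big].$$ Define $$\hat u(t)=\max\Big\{0,\ -1-\gamma\,\frac{g(t)H(t)}{F(t)}+\lambda\,\frac{g(t)}{F(t)}\Big\},$$ where the number $\lambda>0$ is chosen such that $$\int_0^T\hat u(\tau)\,\frac{g(\tau)}{F(\tau)}\,d\tau=-\alpha .$$ Then the unique optimal control that solves $\mathbf{(OC)}_T$ is equal to $\hat u$.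
   Context: All functions are real-valued. $AC(0,T)$ denotes the absolutely continuous functions on $[0,T]$; the differential equation holds for almost every $t\in(0,T)$. *)

(* Defs.v *)
From HB Require Import structures.
From mathcomp Require Import all_boot all_order all_algebra.
From mathcomp Require Import all_classical all_reals all_analysis.

Set Implicit Arguments.
Unset Strict Implicit.
Unset Printing Implicit Defensive.

Import Order.TTheory GRing.Theory Num.Theory.
Import numFieldNormedType.Exports.

Local Open Scope classical_set_scope.
Local Open Scope ring_scope.

(* Functions on [0, T] or [0, +oo[ are represented by total functions R -> R
   whose values outside that interval never matter. *)

Section OptimalControl.
Context {R : realType}.

Local Notation mu := (@lebesgue_measure R).

(* The extension of u by 0 (the default value that restriction uses on R)
   outside ]0, T[ is in L^2(R). Elements of L^2 are represented by functions,
   so equality of controls is equality almost everywhere on ]0, T[. *)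
Definition L2 (T : R) (u : R -> R) : Prop :=
  (u \_ `]0, T[) \in Lfun mu 2%:E.

Definition abs_continuous (a b : R) (y : R -> R) : Prop :=
  forall e : R, 0 < e -> exists2 d : R, 0 < d &
    forall (n : nat) (l r : 'I_n -> R),
      (forall i, [/\ a <= l i, l i <= r i & r i <= b]) ->
      trivIset setT (fun i => `]l i, r i[%classic) ->
      \sum_(i < n) (r i - l i) < d ->
      \sum_(i < n) `|y (r i) - y (l i)| < e.

Definition state (f g : R -> R) (alpha T : R) (u y : R -> R) : Prop :=
  [/\ abs_continuous 0 T y,
      y 0 = alpha &
      {ae mu, forall t : R, t \in `]0, T[ ->
         is_derive t (1 : R) y (f t * y t + g t * u t)}].

Definition feasible (f g : R -> R) (alpha T : R) (u y : R -> R) : Prop :=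
  [/\ L2 T u, state f g alpha T u y & y T = 0].

Definition cost (gamma T : R) (u y : R -> R) : \bar R :=
  (\int[mu]_(t in `[0%R, T])
     (2^-1 * `|u t| ^+ 2 + `|u t| + gamma * `|y t|)%R%:E)%E.

Definition optimal_pair (f g : R -> R) (gamma alpha T : R) (u y : R -> R) :
    Prop :=
  feasible f g alpha T u y /\
  forall v z : R -> R, feasible f g alpha T v z ->
    (cost gamma T u y <= cost gamma T v z)%E.

Definition optimal_control (f g : R -> R) (gamma alpha T : R) (u : R -> R) :
    Prop :=
  exists y : R -> R, optimal_pair f g gamma alpha T u y.

Definition Ffun (f : R -> R) (t : R) : R :=
  expR (\int[mu]_(s in `[0, t]) f s).

Definition Hfun (f : R -> R) (t : R) : R :=
  \int[mu]_(s in `[0, t]) Ffun f s.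

Definition uhat (f g : R -> R) (gamma lambda t : R) : R :=
  Num.max 0 (-1 - gamma * (g t * Hfun f t / Ffun f t)
             + lambda * (g t / Ffun f t)).

End OptimalControl.

(* Main.v *)
Require Import Defs.
From HB Require Import structures.
From mathcomp Require Import all_boot all_order all_algebra.
From mathcomp Require Import all_classical all_reals all_analysis.
From mathcomp Require Import measurable_realfun lra ring.
Import Order.TTheory GRing.Theory Num.Theory.
Import numFieldNormedType.Exports.
Local Open Scope classical_set_scope.
Local Open Scope ring_scope.

(** The optimal pair is certified by a dual variable. With the costate
    [p t = max(0, lambda - gamma * H t)], the function [p * z / F] is absolutely
    continuous for every admissible pair [(v, z)], starts at [lambda * alpha] and
    ends at 0; integrating its derivative [(g / F) p v - gamma r z], where [r] (= [active]) is
    the indicator of [gamma H < lambda], gives the same value for all admissible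
    pairs. Since [|z| >= - r z], the cost minus this constant is bounded below by
    the integral of [v^2/2 + |v| - (g/F) p v], whose integrand is minimized,
    with quadratic growth, by the soft threshold [max(0, (g/F) p - 1)], which is
    [uhat]. Equality holds at [uhat] because its state is nonpositive and has
    already reached 0 once [gamma H >= lambda].

    The fundamental theorem of calculus for absolutely continuous functions
    reduces to the case of an a.e. vanishing derivative, which is proved by a
    Cousin-type induction along the interval: points of zero derivative
    contribute little increment, and the exceptional null set is enclosed in an
    open set of small measure. *)

(** * Absolutely continuous functions *)

Section AbsoluteContinuity.
Context {R : realType}.
Implicit Types (a b : R) (y z k h phi : R -> R).
Local Notation mu := (@lebesgue_measure R).

(** At the supremum c of the points satisfying [P], the two-sided step carries [P] from a point at
    or just left of c either to [b] or to [c + d / 2], and the latter contradicts the supremum. *)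
Lemma real_induction a b (P : R -> Prop) : a <= b -> P a ->
  (forall t, a <= t <= b -> exists2 d, 0 < d & forall s s',
     a <= s -> s <= t -> t <= s' -> s' <= b -> t - d < s -> s' < t + d ->
     P s -> P s') ->
  P b.
Proof.
move=> ab Pa step.
pose S := [set x | a <= x <= b /\ P x].
have Sa : S a by rewrite /S/= lexx ab.
have hS : has_sup S by split; [exists a | exists b => x [/andP[_ ->]]].
have ac : a <= sup S by apply: ub_le_sup; [exact: hS.2 | exact: Sa].
have cb : sup S <= b by apply: sup_le_ub; [exists a | move=> x [/andP[_ ->]]].
have /step[d d0 dP] : a <= sup S <= b by rewrite ac cb.
have [s [/andP[as_ sb] Ps] cs] := sup_adherent d0 hS.
have sc : s <= sup S by apply: ub_le_sup; [exact: hS.2 | split; [rewrite as_ sb|]].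
have [bd|bd] := ltP b (sup S + d); first exact: (dP s b).
have : sup S + d / 2 <= sup S.
  apply: ub_le_sup; first exact: hS.2.
  split; first by lra.
  by apply: (dP s) => //; lra.
lra.
Qed.

Lemma abs_continuous_modulus {a b y} : abs_continuous a b y ->
  forall e, 0 < e -> exists2 d, 0 < d &
    forall s t, a <= s -> s <= t -> t <= b -> t - s < d -> `|y t - y s| < e.
Proof.
move=> acy e /acy[d d0 dP]; exists d => // s t as_ st tb tsd.
have := dP 1%N (fun=> s) (fun=> t); rewrite !big_ord1; apply => //.
by move=> i j _ _ _; rewrite (ord1 i) (ord1 j).
Qed.

(** Common closure criterion behind sums, products and Lipschitz images; when a single function
    controls [k], it is passed as both [y] and [z]. *)
Lemma abs_continuous_le (C : R) y z {a b k} :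
    abs_continuous a b y -> abs_continuous a b z ->
    (forall s t, a <= s -> s <= t -> t <= b ->
      `|k t - k s| <= C * (`|y t - y s| + `|z t - z s|)) ->
  abs_continuous a b k.
Proof.
move=> acy acz kC e e0.
pose D := `|C| + 1.
have D0 : 0 < D by rewrite ltr_wpDl.
have eD : 0 < e / (2 * D) by rewrite divr_gt0// mulr_gt0.
have [d1 d10 d1P] := acy _ eD.
have [d2 d20 d2P] := acz _ eD.
exists (Num.min d1 d2); first by rewrite lt_min d10.
move=> n l r lr triv; rewrite lt_min => /andP[s1 s2].
apply: (@le_lt_trans _ _ (D * (\sum_(i < n) `|y (r i) - y (l i)| +
    \sum_(i < n) `|z (r i) - z (l i)|))).
  rewrite -big_split mulr_sumr ler_sum//= => i _.
  have [al lri rb] := lr i.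
  apply: (le_trans (kC _ _ al lri rb)); rewrite ler_wpM2r ?addr_ge0//.
  by rewrite /D (le_trans (ler_norm C))// lerDl.
have := d1P n l r lr triv s1; have := d2P n l r lr triv s2.
move=> h2 h1; have := ltrD h1 h2.
rewrite -(ltr_pM2l D0) => /lt_le_trans; apply.
by rewrite le_eqVlt; apply/orP; left; apply/eqP; field; rewrite gt_eqF.
Qed.

Lemma abs_continuous_bounded {a b y} : abs_continuous a b y ->
  exists2 M, 0 <= M & forall t, a <= t <= b -> `|y t| <= M.
Proof.
move=> acy; have [d d0 dP] := abs_continuous_modulus acy 1 ltr01.
(* Walking from [a] in steps of [d / 2], each step raises the bound by at most 1. *)
have yn n t : a <= t <= b -> t < a + n%:R * (d / 2) -> `|y t| <= `|y a| + n%:R.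
  elim: n t => [|n IH] t /andP[at_ tb]; first by rewrite mul0r addr0 ltNge at_.
  rewrite -natr1 mulrDl mul1r => tn.
  have [ta|ta] := ltP t (a + d / 2).
    have : `|y t - y a| < 1 by apply: dP => //; lra.
    have := ler_normD (y t - y a) (y a); rewrite subrK.
    have : (0 : R) <= n%:R by [].
    lra.
  have : `|y t - y (t - d / 2)| < 1 by apply: dP => //; lra.
  have := ler_normD (y t - y (t - d / 2)) (y (t - d / 2)); rewrite subrK.
  have : `|y (t - d / 2)| <= `|y a| + n%:R by apply: IH; lra.
  lra.
have d20 : 0 < d / 2 by lra.
exists (`|y a| + (Num.trunc ((b - a) / (d / 2))).+1%:R); first by rewrite addr_ge0.
move=> t /[dup] /andP[at_ tb] tab; apply: yn => //.
rewrite -ltrBlDl -ltr_pdivrMr//.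
apply: (@le_lt_trans _ _ ((b - a) / (d / 2))).
  by rewrite ler_pM2r ?invr_gt0//; lra.
exact: truncnS_gt.
Qed.

Lemma abs_continuousM {a b y z} : abs_continuous a b y -> abs_continuous a b z ->
  abs_continuous a b (fun t => y t * z t).
Proof.
move=> acy acz.
have [M M0 yM] := abs_continuous_bounded acy.
have [N N0 zN] := abs_continuous_bounded acz.
apply: (abs_continuous_le (M + N) y z) => // s t as_ st tb.
have -> : y t * z t - y s * z s = y t * (z t - z s) + (y t - y s) * z s by ring.
apply: (le_trans (ler_normD _ _)); rewrite !normrM.
have yt : `|y t| <= M by apply: yM; rewrite tb andbT (le_trans as_).
have zs : `|z s| <= N by apply: zN; rewrite as_/= (le_trans st).
have := ler_wpM2r (normr_ge0 (z t - z s)) yt.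
have := ler_wpM2l (normr_ge0 (y t - y s)) zs.
have := mulr_ge0 M0 (normr_ge0 (y t - y s)).
have := mulr_ge0 N0 (normr_ge0 (z t - z s)).
lra.
Qed.

(** * Functions whose derivative vanishes almost everywhere *)

Lemma is_derive0_near {h t} : is_derive t (1 : R) h 0 -> forall e, 0 < e ->
  exists2 d, 0 < d & forall x, `|x - t| < d -> `|h x - h t| <= e * `|x - t|.
Proof.
move=> [dh h0] e e0.
have := dh; rewrite /derivable => /cvg_ex[l hl].
have l0 : l = 0.
  by rewrite -h0; apply/esym/cvg_lim => //; exact: norm_hausdorff.
move: hl; rewrite l0 => /cvgr0Pnorm_le /(_ _ e0) /=.
rewrite near_withinE => -[d /= d0 dP].
exists d => // x xt.
have [->|xt0] := eqVneq x t; first by rewrite !subrr normr0 mulr0.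
have xt0' : x - t != 0 by rewrite subr_eq0.
have := dP (x - t); rewrite /ball/= sub0r normrN => /(_ xt xt0').
rewrite [_ *: 1]mulr1 subrK [`|_ *: _|]normrM normfV ler_pdivrMl ?normr_gt0//.
by rewrite mulrC.
Qed.

(** Outer regularity is applied to a measurable null set containing [N]; the open set obtained has
    the measure of its difference with that null set. *)
Lemma negligible_open_cover (N : set R) (d : R) : mu.-negligible N -> 0 < d ->
  exists U, [/\ open U, N `<=` U & (mu U < d%:E)%E].
Proof.
move=> [M [mM M0 NM]] d0.
have [U [oU MU Ud]] : exists U, [/\ open U, M `<=` U & (mu (U `\` M) < d%:E)%E].
  by apply: lebesgue_regularity_outer => //; rewrite [X in (X < _)%E]M0.
exists U; split => //; first exact: subset_trans MU.
have mU : measurable U by exact: open_measurable.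
apply: le_lt_trans Ud.
have : (mu ((U `\` M) `|` M) <= mu (U `\` M) + mu M)%E.
  by apply: measureU2 => //; exact: measurableD.
by rewrite [X in (_ <= _ + X)%E]M0 adde0 setUC setDUK.
Qed.

Lemma measure_bigcup_itv n (l r : 'I_n -> R) :
  (forall i, l i <= r i) -> trivIset setT (fun i => `]l i, r i[%classic) ->
  mu (\big[setU/set0]_(i < n) `]l i, r i[%classic) = (\sum_(i < n) (r i - l i))%:E.
Proof.
move=> lr triv.
rewrite measure_bigsetU_ord//.
rewrite -sumEFin; apply: eq_bigr => i _.
rewrite [LHS]lebesgue_measure_itv/= lte_fin.
by case: ltgtP (lr i) => // ->; rewrite subrr.
Qed.

(** For each tolerance [e] the increment is at most [e * (b - a)] from points of zero derivative,
    plus [e] from the exceptional intervals by absolute continuity. *)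
Lemma abs_continuous_derive0_cst a b h : a <= b -> abs_continuous a b h ->
  {ae mu, forall t, t \in `]a, b[ -> is_derive t (1 : R) h 0} -> h b = h a.
Proof.
move=> ab ach dh.
have main e : 0 < e -> `|h b - h a| <= e * (b - a) + e.
  move=> e0; have [d d0 dP] := ach _ e0.
  (* The endpoints join the exceptional set, so a point outside [U] lies in []a, b[] and has zero
     derivative. *)
  pose N := ~` [set t | t \in `]a, b[ -> is_derive t (1 : R) h 0] `|` [set a; b].
  have nN : mu.-negligible N.
    apply: negligibleU; first exact: dh.
    have n1 x : mu.-negligible [set x].
      by exists [set x]; split => //; exact: lebesgue_measure_set1.
    exact: negligibleU.
  have [U [oU NU Ud]] := negligible_open_cover _ _ nN d0.
  (* Invariant of the induction: finitely many ordered intervals inside [U], to the left of [x],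
     absorb the part of the increment not covered by slope [e]. *)
  pose P x := exists n (l r : nat -> R),
    [/\ forall i, (i < n)%N -> [/\ a <= l i, l i <= r i, r i <= x &
                                   `]l i, r i[ `<=` U],
        forall i j, (i < j < n)%N -> r i <= l j &
        `|h x - h a| <= e * (x - a) + \sum_(i < n) `|h (r i) - h (l i)|].
  have Pb : P b.
    apply: (real_induction a b) => //.
      exists 0%N, (fun=> a), (fun=> a); split => [//|i j|].
        by rewrite ltn0 andbF.
      by rewrite !subrr big_ord0 normr0 mulr0 addr0.
    move=> t /andP[at_ tb].
    have [Ut|Ut] := pselect (U t).
      have [d' /= d'0 dU] : nbhs t U by exact: open_nbhs_nbhs.
      (* Near a point of [U] the whole interval from [s] to [s'] lies in [U] and is appended to the
         list as number [n]. *)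
      exists d' => // s s' as_ st ts s'b sd s'd [n [l [r [lr rl hs]]]].
      exists n.+1, (fun i => if i == n then s else l i),
        (fun i => if i == n then s' else r i); split.
      - move=> i; rewrite ltnS leq_eqVlt; case: eqVneq => /= [_ _|_ /lr[? ? rs ?]].
          split => //; first by lra.
          move=> x /=; rewrite in_itv/= => /andP[sx xs]; apply: dU.
          by rewrite /ball/= ltr_distl; lra.
        by split => //; lra.
      - move=> i j /andP[ij]; rewrite ltnS => jn.
        rewrite ltn_eqF ?(leq_trans ij)//.
        case: eqVneq jn ij => [-> _ /lr[_ _ ris _]|jn0 jn ij].
          exact: le_trans ris _.
        by apply: rl; rewrite ij ltn_neqAle jn0.
      - rewrite big_ord_recr/= eqxx.
        under eq_bigr do rewrite ltn_eqF ?ltn_ord//.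
        have := ler_normD (h s' - h s) (h s - h a).
        rewrite addrA subrK.
        have : e * (s - a) <= e * (s' - a) by rewrite ler_pM2l//; lra.
        lra.
    have tab : t \in `]a, b[.
      rewrite in_itv/= !lt_neqAle at_ tb !andbT; apply/andP; split; apply/eqP => tE.
        by apply: Ut; apply: NU; right; left.
      by apply: Ut; apply: NU; right; right.
    have ht : is_derive t 1 h 0.
      by apply: contrapT => ht; apply: Ut; apply: NU; left => /(_ tab).
    have [d' d'0 dh'] := is_derive0_near ht _ e0.
    (* At a point of zero derivative the list is kept; the increment from [s] to [s'], split at [t],
       is at most [e * (s' - s)]. *)
    exists d' => // s s' as_ st ts s'b sd s'd [n [l [r [lr rl hs]]]].
    exists n, l, r; split => // [i /lr[? ? rs ?]|].
      by split => //; rewrite (le_trans rs)// (le_trans st).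
    have h1 : `|h s' - h t| <= e * (s' - t).
      by rewrite (le_trans (dh' _ _)) ?ger0_norm ?subr_ge0//; lra.
    have h2 : `|h t - h s| <= e * (t - s).
      rewrite distrC (le_trans (dh' _ _)) ?ler0_norm ?subr_le0//; first lra.
      by rewrite opprB.
    have := ler_normD (h s' - h t) (h t - h s).
    have := ler_normD (h s' - h s) (h s - h a).
    rewrite !addrA !subrK; nra.
  have [n [l [r [lr rl hb]]]] := Pb.
  apply: (le_trans hb); rewrite lerD2l ltW//.
  have triv : trivIset setT (fun i : 'I_n => `]l i, r i[%classic).
    move=> i j _ _ [x /=]; rewrite !in_itv/= => -[/andP[lix xri] /andP[ljx xrj]].
    apply/val_inj/eqP; rewrite /= eqn_leq leqNgt [(j <= i)%N]leqNgt.
    apply/andP; split; apply/negP => ij.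
      have := rl _ _ (introT andP (conj ij (ltn_ord i))); lra.
    have := rl _ _ (introT andP (conj ij (ltn_ord j))); lra.
  apply: (dP n (fun i => l i) (fun i => r i)) => // [i|].
    by have [] := lr _ (ltn_ord i).
  (* The total length is the measure of a disjoint union inside [U], hence below the [d] of absolute
     continuity. *)
  rewrite -lte_fin -measure_bigcup_itv//; last first.
    by move=> i; have [] := lr _ (ltn_ord i).
  apply: le_lt_trans Ud; apply: le_measure; rewrite ?inE.
  - by apply: bigsetU_measurable => i _; exact: measurable_itv.
  - exact: open_measurable.
  - by rewrite -bigcup_seq => x [i _]; have [_ _ _] := lr _ (ltn_ord i); apply.
apply/eqP; rewrite -subr_eq0 -normr_le0.
apply/ler_addgt0Pr => e e0; rewrite add0r.
have c0 : 0 < b - a + 1 by lra.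
(* Dividing by [b - a + 1] turns the bound [e * (b - a) + e] into [e], also when [a = b]. *)
have := main (e / (b - a + 1)); rewrite divr_gt0// => /(_ isT) /le_trans; apply.
by rewrite le_eqVlt; apply/orP; left; apply/eqP; field; rewrite gt_eqF.
Qed.

(** Fixes the filter instance of Lebesgue measure; uses with a single premise pass that premise
    twice. *)
Lemma lebesgue_aeS2 (P Q S : R -> Prop) : (forall x, P x -> Q x -> S x) ->
  {ae mu, forall x, P x} -> {ae mu, forall x, Q x} -> {ae mu, forall x, S x}.
Proof.
by move=> PQS; apply: filterS2 PQS; exact: (ae_filter_ringOfSetsType mu).
Qed.

(** * Indefinite integrals and the fundamental theorem of calculus *)

Lemma Rintegral_abs_bigcup_itv n (l r : 'I_n -> R) phi :
  mu.-integrable setT (EFin \o phi) ->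
  trivIset setT (fun i => `]l i, r i[%classic) ->
  \int[mu]_(x in \big[setU/set0]_(i < n) `]l i, r i[%classic) `|phi x| =
  \sum_(i < n) \int[mu]_(x in `]l i, r i[) `|phi x|.
Proof.
move=> intphi triv.
have iphi D : measurable D -> mu.-integrable D (EFin \o (fun x => `|phi x|)).
  by move=> mD; apply: integrableS (integrable_norm intphi).
apply: EFin_inj; rewrite -sumEFin /Rintegral fineK; last first.
  by apply: integrable_fin_num; [|apply: iphi]; exact: bigsetU_measurable.
rewrite ge0_integral_bigsetU//=.
- apply: eq_bigr => i _; rewrite fineK//.
  by apply: integrable_fin_num => //; exact: iphi.
- exact: index_enum_uniq.
- exact: sub_trivIset triv.
- by apply: measurable_int; apply: iphi; apply: bigsetU_measurable.
Qed.

(** Extension by 0 moves integrability to the whole line, where absolute continuity of the integral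
    and Lebesgue differentiation are applied. *)
Lemma integrable_restrict a b phi : mu.-integrable `[a, b] (EFin \o phi) ->
  mu.-integrable setT (EFin \o (phi \_ `[a, b])).
Proof. by move=> /integrable_mkcond; rewrite restrict_EFin; apply. Qed.

Lemma Rintegral_restrict a b phi t : t <= b ->
  \int[mu]_(x in `[a, t]) phi x = \int[mu]_(x in `[a, t]) (phi \_ `[a, b]) x.
Proof.
move=> tb; apply: eq_Rintegral => x; rewrite inE/= in_itv/= => /andP[ax xt].
by rewrite patchE mem_set//= in_itv/= ax (le_trans xt).
Qed.

Lemma Rintegral_itv_sub a s t phi : mu.-integrable `[a, t] (EFin \o phi) ->
  a <= s -> s <= t ->
  \int[mu]_(x in `[a, t]) phi x - \int[mu]_(x in `[a, s]) phi x =
  \int[mu]_(x in `]s, t[) phi x.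
Proof.
move=> iphi as_ st; rewrite Rintegral_itvB// Rintegral_itv_bndo_bndc//.
apply: integrableS iphi => //; apply: subset_itvW => //.
Qed.

(** The integral of [|phi|] is small on sets of small measure; this is applied to the union of the
    intervals, whose measure is their total length. *)
Lemma abs_continuous_integral a b phi : mu.-integrable `[a, b] (EFin \o phi) ->
  abs_continuous a b (fun t => \int[mu]_(s in `[a, t]) phi s).
Proof.
move=> iphi e e0.
have iphi' := integrable_restrict _ _ _ iphi.
have [d [d0 dP]] := integral_normr_continuous iphi' e0.
exists d => // n l r lr triv lrd.
apply: le_lt_trans (dP (\big[setU/set0]_(i < n) `]l i, r i[%classic) _ _); last 2 first.
- by apply: bigsetU_measurable.
- rewrite [X in (X < _)%E](measure_bigcup_itv _ _ _ _ triv) ?lte_fin// => i.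
  by have [] := lr i.
rewrite Rintegral_abs_bigcup_itv//; apply: ler_sum => i _.
have [al lri rb] := lr i.
rewrite (Rintegral_restrict _ _ _ _ rb) (Rintegral_restrict _ _ _ _ (le_trans lri rb)).
rewrite Rintegral_itv_sub//; last exact: integrableS iphi'.
by apply: le_normr_Rintegral => //; exact: integrableS iphi'.
Qed.

Lemma is_derive_integral_ae a b phi : mu.-integrable `[a, b] (EFin \o phi) ->
  {ae mu, forall t, t \in `]a, b[ ->
    is_derive t (1 : R) (fun t => \int[mu]_(s in `[a, t]) phi s) (phi t)}.
Proof.
move=> iphi.
have iphi' := integrable_restrict _ _ _ iphi.
have li : locally_integrable setT (phi \_ `[a, b]) by exact: integrable_locally.
have ii c : mu.-integrable [set` Interval (BLeft a) (BRight c)] (EFin \o (phi \_ `[a, b])).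
  exact: integrableS iphi'.
have aeF := FTC1 ii li.
apply: (lebesgue_aeS2 _ _ _ _ aeF aeF) => t /= ft _; rewrite in_itv/= => /andP[at_ tb].
have {ft} [|ft f't] := ft; first by rewrite lte_fin.
apply: near_eq_is_derive; last first.
  apply: DeriveDef; first exact: ft.
  by rewrite -derive1E f't patchE mem_set//= in_itv/= !ltW.
(* Since [t < b], all [s] near [t] stay below [b], where the restriction does not change the
   integral. *)
near=> s; apply/esym/Rintegral_restrict; near: s.
exact: lt_le_nbhsl.
Unshelve. all: by end_near. Qed.

(** [y] minus the indefinite integral of [phi] is absolutely continuous with zero derivative almost
    everywhere, hence constant. *)
Lemma abs_continuous_FTC a b y phi : abs_continuous a b y ->
  mu.-integrable `[a, b] (EFin \o phi) ->
  {ae mu, forall t, t \in `]a, b[ -> is_derive t (1 : R) y (phi t)} ->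
  forall t, t \in `[a, b] -> y t = y a + \int[mu]_(s in `[a, t]) phi s.
Proof.
move=> acy iphi dy t; rewrite in_itv/= => /andP[at_ tb].
pose I u := \int[mu]_(s in `[a, u]) phi s.
have acI : abs_continuous a b I by exact: abs_continuous_integral.
have aeI : {ae mu, forall t, t \in `]a, b[ -> is_derive t (1 : R) I (phi t)}.
  exact: is_derive_integral_ae.
pose h u := y u - I u.
have ach : abs_continuous a b h.
  apply: (abs_continuous_le 1 y I) => // s u _ _ _.
  rewrite mul1r; have -> : h u - h s = (y u - y s) - (I u - I s) by rewrite /h; ring.
  exact: ler_normB.
have : h t = h a.
  apply: abs_continuous_derive0_cst => //.
    move=> e /ach[d d0 dP]; exists d => // n l r lr; apply: dP => i.
    by have [? ? rt] := lr i; split => //; exact: le_trans tb.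
  apply: (lebesgue_aeS2 _ _ _ _ dy aeI) => u yu Iu; rewrite in_itv/= => /andP[au ut].
  have uab : u \in `]a, b[ by rewrite in_itv/= au (lt_le_trans ut).
  by apply: is_derive_eq; [exact: is_deriveB (yu uab) (Iu uab)|rewrite subrr].
rewrite /h /I set_itv1 Rintegral_set1 subr0 => /eqP; rewrite subr_eq => /eqP.
by rewrite addrC.
Qed.

(** * Bounded measurable functions *)

(** A class of multipliers preserving integrability on [[a, b]]; values outside the interval are
    left free, as for all functions on [[0, T]] here. *)
Definition bounded_measurable (a b : R) (h : R -> R) :=
  measurable_fun `[a, b] h /\ exists M, forall t, a <= t <= b -> `|h t| <= M.

Lemma bounded_measurableM {a b h k} : bounded_measurable a b h ->
  bounded_measurable a b k -> bounded_measurable a b (fun t => h t * k t).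
Proof.
move=> [mh [M hM]] [mk [N kN]]; split; first exact: measurable_funM.
exists (M * N) => t tab; rewrite normrM ler_pM//; [exact: hM|exact: kN].
Qed.

Lemma bounded_measurableD {a b h k} : bounded_measurable a b h ->
  bounded_measurable a b k -> bounded_measurable a b (fun t => h t + k t).
Proof.
move=> [mh [M hM]] [mk [N kN]]; split; first exact: measurable_funD.
exists (M + N) => t tab; rewrite (le_trans (ler_normD _ _))// lerD//.
  exact: hM.
exact: kN.
Qed.

Lemma bounded_measurable_cst a b (c : R) : bounded_measurable a b (fun=> c).
Proof. by split; [exact: measurable_cst|exists `|c|]. Qed.

Lemma integrable_bounded_measurableM {a b h phi} : bounded_measurable a b h ->
  mu.-integrable `[a, b] (EFin \o phi) ->
  mu.-integrable `[a, b] (EFin \o (fun t => h t * phi t)).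
Proof.
move=> [mh [M hM]] iphi.
have -> : EFin \o (fun t => h t * phi t) = ((EFin \o h) \* (EFin \o phi))%E.
  by apply/funext => t /=; rewrite EFinM.
apply: integrableMr => //.
exists M; split; first exact: num_real.
by move=> N MN t; rewrite /= in_itv/= => /hM /le_trans; apply; exact: ltW.
Qed.

Lemma bounded_measurable_integrable {a b h} : bounded_measurable a b h ->
  mu.-integrable `[a, b] (EFin \o h).
Proof.
move=> [mh [M hM]]; apply: measurable_bounded_integrable => //.
  by rewrite [X in (X < _)%E]lebesgue_measure_itv; case: ifPn => _; rewrite -?EFinB ltry.
exists M; split; first exact: num_real.
by move=> N MN t; rewrite /= in_itv/= => /hM /le_trans; apply; exact: ltW.
Qed.

Lemma abs_continuous_within {a b y} : abs_continuous a b y ->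
  {within `[a, b], continuous y}.
Proof.
move=> acy; apply/subspace_continuousP => x; rewrite /= in_itv/= => /andP[ax xb].
apply/cvgrPdist_lt => e e0.
have [d d0 dP] := abs_continuous_modulus acy e e0.
rewrite near_withinE; exists d => //= t; rewrite /ball/= => xt.
rewrite in_itv/= => /andP[at_ tb].
have [xlt|tlx] := leP x t.
  by rewrite distrC; apply: dP => //; move: xt; rewrite ltr_distlC; lra.
by apply: dP => //; [exact: ltW|move: xt; rewrite ltr_distlC; lra].
Qed.

Lemma within_continuous_bounded_measurable {a b h} :
  {within `[a, b], continuous h} -> bounded_measurable a b h.
Proof.
move=> ch; split; first exact: subspace_continuous_measurable_fun.
have [M [_ hM]] := compact_bounded (continuous_compact ch (@segment_compact _ a b)).
(* Compactness yields every number strictly above [M] as a bound, whence [M + 1]. *)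
exists (M + 1) => t tab; apply: hM; first by rewrite ltrDl.
by exists t => //=; rewrite in_itv.
Qed.

Lemma abs_continuous_bounded_measurable {a b y} : abs_continuous a b y ->
  bounded_measurable a b y.
Proof. by move=> /abs_continuous_within /within_continuous_bounded_measurable. Qed.

(** The exponent is bounded by some [M], and exp is Lipschitz with constant [expR M] on []-oo,
    M]]. *)
Lemma abs_continuous_expR {a b y} : abs_continuous a b y ->
  abs_continuous a b (fun t => expR (y t)).
Proof.
move=> acy; have [M M0 yM] := abs_continuous_bounded acy.
have lip x1 x2 : x2 <= M -> x1 <= x2 -> `|expR x2 - expR x1| <= expR M * (x2 - x1).
  move=> x2M x12; rewrite ger0_norm ?subr_ge0 ?ler_expR//.
  have -> : expR x2 - expR x1 = expR x2 * (1 - expR (x1 - x2)).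
    by rewrite mulrBr mulr1 -expRD subrKC.
  (* The tangent at 0 gives [1 - expR (x1 - x2) <= x2 - x1]. *)
  have h1 := expR_ge1Dx (x1 - x2).
  have h2 : expR x2 <= expR M by rewrite ler_expR.
  have h3 := expR_gt0 x2.
  apply: (@le_trans _ _ (expR x2 * (x2 - x1))).
    by rewrite ler_pM2l//; lra.
  by rewrite ler_wpM2r// subr_ge0.
apply: (abs_continuous_le (expR M) y y) => // s t as_ st tb.
have ys : y s <= M by rewrite (le_trans (ler_norm _))// yM// as_ (le_trans st).
have yt : y t <= M by rewrite (le_trans (ler_norm _))// yM// tb (le_trans as_).
have e0 := expR_gt0 M.
apply: (@le_trans _ _ (expR M * `|y t - y s|)); last first.
  by rewrite ler_pM2l// lerDl.
have [yst|yts] := leP (y s) (y t).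
  by rewrite (ger0_norm (_ : 0 <= y t - y s)) ?subr_ge0//; exact: lip.
rewrite distrC (distrC (y t)) (ger0_norm (_ : 0 <= y s - y t)) ?subr_ge0 ?(ltW yts)//.
by apply: lip => //; exact: ltW.
Qed.

(** The endpoints are null; this bridges [L2], stated on []0, T[], and integrals over [[0, T]]. *)
Lemma integrable_itv_cc (a b : R) (h : R -> R) :
  mu.-integrable `]a, b[ (EFin \o h) ->
  mu.-integrable `[a, b] (EFin \o h).
Proof.
move=> /integrableP[mh ih].
have mh' : measurable_fun `]a, b[ (fun x => `|(h x)%:E|%E).
  exact: measurableT_comp mh.
apply/integrableP; split; first exact: emeasurable_fun_itv_cc mh.
rewrite -integral_itv_bndo_bndc; last first.
  exact/emeasurable_fun_itv_obnd_cbndP.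
by rewrite -integral_itv_obnd_cbnd.
Qed.

Lemma integrable_addr {a b : R} {h k : R -> R} :
  mu.-integrable `[a, b] (EFin \o h) ->
  mu.-integrable `[a, b] (EFin \o k) ->
  mu.-integrable `[a, b] (EFin \o (fun t => h t + k t)).
Proof.
move=> ih ik; have -> : EFin \o (fun t => h t + k t) = ((EFin \o h) \+ (EFin \o k))%E.
  by apply/funext => t /=; rewrite EFinD.
exact: integrableD.
Qed.

Lemma Rintegral_addr {a b : R} {h k : R -> R} :
  mu.-integrable `[a, b] (EFin \o h) ->
  mu.-integrable `[a, b] (EFin \o k) ->
  \int[mu]_(t in `[a, b]) (h t + k t) =
  \int[mu]_(t in `[a, b]) h t +
  \int[mu]_(t in `[a, b]) k t.
Proof. by move=> ih ik; rewrite RintegralD. Qed.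

(** * Positive parts, square-integrability and the soft threshold *)

Lemma max0_lipschitz (x y : R) :
  `|Num.max 0 x - Num.max 0 y| <= `|x - y|.
Proof.
have /andP[] : - `|x - y| <= x - y <= `|x - y| by rewrite -ler_norml.
rewrite ler_norml; move: `|x - y| => d.
by have [] := leP 0 x; have [] := leP 0 y => *; apply/andP; split; lra.
Qed.

Lemma bounded_measurable_max0 {a b : R} {h : R -> R} :
  bounded_measurable a b h -> bounded_measurable a b (fun t => Num.max 0 (h t)).
Proof.
move=> [mh [M hM]]; split; first exact: measurable_maxr.
exists M => t /hM; have := max0_lipschitz (h t) 0.
by rewrite maxxx !subr0; exact: le_trans.
Qed.

Lemma bounded_measurable_L2 (T : R) (u : R -> R) :
  bounded_measurable 0 T u -> L2 T u.
Proof.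
move=> bu; have mu0 : measurable_fun setT (u \_ `]0, T[).
  apply/(measurable_restrictT _ (measurable_itv `]0, T[)) => //.
  by apply: measurable_funS bu.1 => //; exact: subset_itvW.
rewrite /L2 inE; apply/andP; split; rewrite inE//=.
rewrite /finite_norm unlock; apply: poweR_lty.
have : mu.-integrable `]0, T[ (EFin \o (fun t => u t * u t)).
  apply: integrableS (bounded_measurable_integrable (bounded_measurableM bu bu)) => //.
  exact: subset_itvW.
move=> /integrable_mkcond-/(_ (measurable_itv _)) /integrableP[_].
apply: le_lt_trans; rewrite le_eqVlt; apply/orP; left; apply/eqP.
apply: eq_integral => t _ /=; rewrite powR_mulrn// !patchE; case: ifPn => _ /=.
  by rewrite normrM expr2.
by rewrite normr0 expr0n.
Qed.

(** The right-hand side is strongly convex in [v] and minimized by the soft threshold of [c] at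
    level 1; the last term on the left is its quadratic growth. As [c >= 0], the negative branch of
    the threshold does not occur. *)
Lemma soft_threshold_min (v c : R) : 0 <= c ->
  2^-1 * `|Num.max 0 (c - 1)| ^+ 2 + `|Num.max 0 (c - 1)|
    - c * Num.max 0 (c - 1) + 2^-1 * (v - Num.max 0 (c - 1)) ^+ 2 <=
  2^-1 * `|v| ^+ 2 + `|v| - c * v.
Proof.
move=> c_ge0; rewrite !real_normK ?num_real//.
have v1 := ler_norm v; have := ler_norm (- v); rewrite normrN => v2.
(* The gap between the two sides is [|v| - v] when [c >= 1], and [|v| - c * v] when [c < 1]. *)
have [c1|c1] := leP 0 (c - 1); last by rewrite normr0; nra.
by rewrite ger0_norm//; nra.
Qed.

End AbsoluteContinuity.

(** * The controlled equation *)

Section ControlSystem.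
Context {R : realType} {f g : R -> R} {T : R}.
Context (cf : {within `[0, +oo[, continuous f})
  (cg : {within `[0, +oo[, continuous g})
  (f_gt0 : forall t : R, 0 <= t -> 0 < f t)
  (g_gt0 : forall t : R, 0 <= t -> 0 < g t) (T_gt0 : 0 < T).
Local Notation mu := (@lebesgue_measure R).
Local Notation F := (Ffun f).
Local Notation H := (Hfun f).

Lemma bounded_measurable_itvcy (h : R -> R) : {within `[0, +oo[, continuous h} ->
  bounded_measurable 0 T h.
Proof.
move=> ch; apply/within_continuous_bounded_measurable/continuous_subspaceW/ch.
by apply: subset_itvl.
Qed.

Let fint : mu.-integrable `[0, T] (EFin \o f).
Proof. exact/bounded_measurable_integrable/bounded_measurable_itvcy. Qed.

(** * The integrating factor [F] *)

Lemma Ffun_gt0 t : 0 < F t. Proof. exact: expR_gt0. Qed.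

Lemma Ffun0 : F 0 = 1.
Proof. by rewrite /Ffun set_itv1 Rintegral_set1 expR0. Qed.

Lemma Ffun_ge1 t : 1 <= F t.
Proof.
rewrite -expR0 ler_expR; apply: Rintegral_ge0 => s /=; rewrite in_itv/=.
by move=> /andP[s0 _]; rewrite ltW// f_gt0.
Qed.

Lemma abs_continuous_Ffun : abs_continuous 0 T F.
Proof. exact/abs_continuous_expR/abs_continuous_integral. Qed.

Lemma invFfunE t : (F t)^-1 = expR (- \int[mu]_(s in `[0, t]) f s).
Proof. by rewrite expRN. Qed.

(** Writing [1 / F] as an exponential reuses the result on exponentials in place of a quotient
    rule. *)
Lemma abs_continuous_invFfun : abs_continuous 0 T (fun t => (F t)^-1).
Proof.
under eq_fun do rewrite invFfunE.
pose I t := \int[mu]_(s in `[0, t]) f s.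
apply: (@abs_continuous_expR _ _ _ (fun t => - I t)).
have acI : abs_continuous 0 T I by exact: abs_continuous_integral.
apply: (abs_continuous_le 1 I I) => // s t _ _ _.
by rewrite mul1r -opprD normrN lerDl.
Qed.

Lemma is_derive_Ffun_ae : {ae mu, forall t, t \in `]0, T[ ->
  is_derive t (1 : R) F (f t * F t)}.
Proof.
have aef := is_derive_integral_ae _ _ _ fint.
apply: (lebesgue_aeS2 _ _ _ _ aef aef) => t ft _ /ft {}ft.
by rewrite mulrC; exact: is_derive1_comp (is_derive_expR _) ft.
Qed.

Lemma is_derive_invFfun {t} : is_derive t (1 : R) F (f t * F t) ->
  is_derive t (1 : R) (fun t => (F t)^-1) (- (f t / F t)).
Proof.
move=> Ft; apply: is_derive_eq; first exact: is_deriveV (lt0r_neq0 (Ffun_gt0 t)) Ft.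
rewrite [_ *: _]mulNr; congr (- _); field; exact/lt0r_neq0/Ffun_gt0.
Qed.

Lemma bounded_measurable_gF : bounded_measurable 0 T (fun t => g t / F t).
Proof.
apply: bounded_measurableM; first exact: bounded_measurable_itvcy.
exact/abs_continuous_bounded_measurable/abs_continuous_invFfun.
Qed.

(** * Square-integrable controls and the state formula *)

Lemma L2_measurable u : L2 T u -> measurable_fun `[0, T] u.
Proof.
rewrite /L2 inE => /andP[+ _]; rewrite inE/= => mu0.
apply: measurable_fun_itv_cc.
exact/(measurable_restrictT _ (measurable_itv `]0, T[)).
Qed.

Lemma L2_integrable_sqr u : L2 T u ->
  mu.-integrable `[0, T] (EFin \o (fun t => u t ^+ 2)).
Proof.
move=> u2; have mu0 := L2_measurable u u2.
apply: integrable_itv_cc.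
have : mu.-integrable `]0, T[ (EFin \o (fun t => (u \_ `]0, T[) t ^+ 2)).
  exact: integrableS (Lfun2_integrable_sqr u2).
apply: eq_integrable => // t t0T.
by rewrite /= patchE t0T.
Qed.

Lemma L2_integrable u : L2 T u -> mu.-integrable `[0, T] (EFin \o u).
Proof.
move=> u2; have mu0 := L2_measurable u u2.
have i1 : mu.-integrable `[0, T] (EFin \o (fun=> 1)).
  exact/bounded_measurable_integrable/bounded_measurable_cst.
(* [|u|] is dominated by [u ^+ 2 + 1], because [(|u| - 1) ^+ 2 >= 0]. *)
apply: (le_integrable _ _ _ (integrableD _ (L2_integrable_sqr u u2) i1)) => //.
  exact/measurable_EFinP.
move=> t _ /=; rewrite lee_fin [leRHS]ger0_norm ?addr_ge0 ?sqr_ge0//.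
have := sqr_ge0 (`|u t| - 1); rewrite sqrrB1 -normrX ger0_norm ?sqr_ge0//.
have := normr_ge0 (u t); lra.
Qed.

(** [1 / F] is an integrating factor: the terms containing [f] cancel. *)
Lemma is_derive_div_Ffun u y t : is_derive t (1 : R) F (f t * F t) ->
  is_derive t (1 : R) y (f t * y t + g t * u t) ->
  is_derive t (1 : R) (fun s => y s / F s) (g t / F t * u t).
Proof.
move=> /is_derive_invFfun Ft yt; apply: is_derive_eq.
rewrite -![_ *: _]/(_ * _).
ring.
Qed.

Lemma abs_continuous_eq (y z : R -> R) : {in `[0, T], y =1 z} ->
  abs_continuous 0 T y -> abs_continuous 0 T z.
Proof.
move=> yz acy; apply: (abs_continuous_le 1 y y) => // s t s0 st tT.
rewrite mul1r !yz ?in_itv/= ?s0 ?tT ?andbT ?(le_trans st)// ?(le_trans s0)//.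
by rewrite lerDl.
Qed.

Lemma integrable_gF_control u : L2 T u ->
  mu.-integrable `[0, T] (EFin \o (fun t => g t / F t * u t)).
Proof.
move=> u2; apply: (integrable_bounded_measurableM bounded_measurable_gF).
exact: L2_integrable.
Qed.

(** Variation of constants: one direction integrates the derivative of [y / F], the other
    differentiates the formula almost everywhere. *)
Lemma state_formula alpha u y : L2 T u -> state f g alpha T u y <->
  (forall t, t \in `[0, T] ->
     y t = F t * (alpha + \int[mu]_(tau in `[0, t]) (g tau / F tau * u tau))).
Proof.
move=> u2; have igu := integrable_gF_control u u2.
pose K t := \int[mu]_(tau in `[0, t]) (g tau / F tau * u tau).
split => [[acy y0 dy] t t0T|yE].
  have acw := abs_continuousM acy abs_continuous_invFfun.
  have dw : {ae mu, forall t, t \in `]0, T[ ->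
      is_derive t (1 : R) (fun s => y s / F s) (g t / F t * u t)}.
    apply: (lebesgue_aeS2 _ _ _ _ is_derive_Ffun_ae dy) => s Fs ys s0T.
    by apply: is_derive_div_Ffun; [exact: Fs|exact: ys].
  have := abs_continuous_FTC _ _ _ _ acw igu dw _ t0T.
  rewrite Ffun0 divr1 y0 => <-; rewrite mulrC divfK//.
  exact/lt0r_neq0/Ffun_gt0.
have acK : abs_continuous 0 T K by exact: abs_continuous_integral.
have acKa : abs_continuous 0 T (fun t => alpha + K t).
  apply: (abs_continuous_le 1 K K) => // s t _ _ _.
  by rewrite mul1r opprD addrACA subrr add0r lerDl.
split.
- apply: abs_continuous_eq (abs_continuousM abs_continuous_Ffun acKa).
  by move=> t /yE ->.
- rewrite yE ?in_itv/= ?lexx ?ltW//.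
  by rewrite Ffun0 set_itv1 Rintegral_set1 addr0 mul1r.
- have dK := is_derive_integral_ae _ _ _ igu.
  apply: (lebesgue_aeS2 _ _ _ _ is_derive_Ffun_ae dK) => t Ft Kt t0T.
  (* [y] follows the formula only on [[0, T]], so derivatives are compared on a neighbourhood of [t]
     inside []0, T[]. *)
  apply: (@near_eq_is_derive _ _ _ (fun t => F t * (alpha + K t))).
    have := near_in_itvoo t0T; apply: filterS => s s0T; rewrite yE//.
    exact: subset_itv_oo_cc.
  apply: is_derive_eq.
    exact: is_deriveM (Ft t0T) (is_deriveD (is_derive_cst alpha t 1) (Kt t0T)).
  rewrite -![_ *: _]/(_ * _) yE; last exact: subset_itv_oo_cc.
  change (F t * (0 + g t / F t * u t) + (alpha + K t) * (f t * F t) =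
    f t * (F t * (alpha + K t)) + g t * u t).
  field.
  exact/lt0r_neq0/Ffun_gt0.
Qed.

(** * The function [H] and the running cost *)

Lemma bounded_measurable_Ffun : bounded_measurable 0 T F.
Proof. exact/abs_continuous_bounded_measurable/abs_continuous_Ffun. Qed.

Lemma abs_continuous_Hfun : abs_continuous 0 T H.
Proof.
exact/abs_continuous_integral/bounded_measurable_integrable/bounded_measurable_Ffun.
Qed.

(** Since [F >= 1], the increment of [H] is at least [t - s]. *)
Lemma ltr_Hfun s t : 0 <= s -> s < t -> t <= T -> H s < H t.
Proof.
move=> s0 st tT.
have iF : mu.-integrable `[0, t] (EFin \o F).
  apply: integrableS (bounded_measurable_integrable bounded_measurable_Ffun) => //.
  exact: subset_itvl.
rewrite -subr_gt0 (Rintegral_itv_sub _ _ _ _ iF)// ?ltW//.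
apply: (@lt_le_trans _ _ (\int[mu]_(x in `]s, t[) 1)).
  rewrite Rintegral_cst// mul1r.
  by rewrite [X in fine X]lebesgue_measure_itv/= lte_fin st/= subr_gt0.
apply: le_Rintegral => //.
- apply: measurable_bounded_integrable => //.
    by rewrite [X in (X < _)%E]lebesgue_measure_itv; case: ifPn => _; rewrite -?EFinB ltry.
  by exists 1; split; [exact: num_real|move=> N N1 x _ /=; rewrite normr1 ltW].
- apply: integrableS iF => //; apply: subset_itvW => //; exact: ltW.
- by move=> x _; exact: Ffun_ge1.
Qed.

Definition running_cost (gamma : R) (u y : R -> R) (t : R) : R :=
  2^-1 * `|u t| ^+ 2 + `|u t| + gamma * `|y t|.

Lemma integrable_running_cost gamma u y : L2 T u -> abs_continuous 0 T y ->
  mu.-integrable `[0, T] (EFin \o running_cost gamma u y).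
Proof.
move=> u2 acy; apply: integrable_addr; first apply: integrable_addr.
- apply: (integrable_bounded_measurableM (bounded_measurable_cst _ _ _)).
  have -> : (fun t => `|u t| ^+ 2) = (fun t => u t ^+ 2).
    by apply/funext => t; rewrite real_normK// num_real.
  exact: L2_integrable_sqr.
- exact: integrable_norm (L2_integrable u u2).
- apply: (integrable_bounded_measurableM (bounded_measurable_cst _ _ _)).
  apply: integrable_norm.
  exact: bounded_measurable_integrable (abs_continuous_bounded_measurable acy).
Qed.

(** The cost is finite here, so costs can be compared as real integrals. *)
Lemma cost_running_cost gamma u y : L2 T u -> abs_continuous 0 T y ->
  cost gamma T u y = (\int[mu]_(t in `[0, T]) running_cost gamma u y t)%:E.
Proof.
move=> u2 acy; rewrite fineK//.
exact: integrable_fin_num (integrable_running_cost gamma u y u2 acy).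
Qed.

(** * Costate and optimality *)

Section Costate.
Context {gamma lambda : R}.
Context (gamma_ge1 : 1 <= gamma) (lambda_gt0 : 0 < lambda).

(** The adjoint state times the integrating factor: almost everywhere on []0, T[], [q = costate / F]
    solves [q' = - f q - gamma r] with [r] = [active], where [- r] is a subgradient of the absolute
    value along the optimal state. *)
Definition costate t := Num.max 0 (lambda - gamma * H t).
Definition active t : R := if gamma * H t < lambda then 1 else 0.

Lemma abs_continuous_costate : abs_continuous 0 T costate.
Proof.
apply: (abs_continuous_le gamma H H); [exact: abs_continuous_Hfun..|].
move=> s t _ _ _; apply: (le_trans (max0_lipschitz _ _)).
have -> : lambda - gamma * H t - (lambda - gamma * H s) = - (gamma * (H t - H s)) by ring.
have g0 : 0 < gamma by exact: lt_le_trans gamma_ge1.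
by rewrite normrN normrM gtr0_norm// ler_pM2l// lerDl.
Qed.

(** Off the kink, continuity of [H] keeps one branch of the maximum in force on a neighbourhood of
    [t]. *)
Lemma is_derive_costate t : is_derive t (1 : R) H (F t) ->
  gamma * H t != lambda -> is_derive t (1 : R) costate (- (gamma * active t * F t)).
Proof.
move=> dH; have cH : {for t, continuous H}.
  by apply/differentiable_continuous/derivable1_diffP; case: dH.
have cgH : gamma * H s @[s --> t] --> gamma * H t by apply: cvgM; [exact: cvg_cst|].
rewrite /active neq_lt => /orP[Ht|Ht].
  rewrite Ht mulr1; apply: (@near_eq_is_derive _ _ _ (fun s => lambda - gamma * H s)).
    near=> s; rewrite /costate max_r// subr_ge0 ltW//; near: s.
    exact: cvgr_lt cgH _ Ht.
  have dl := is_deriveB (is_derive_cst lambda t 1)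
    (is_deriveM (is_derive_cst gamma t 1) dH).
  apply: (is_derive_eq dl).
  by rewrite -![_ *: _]/(_ * _) mulr0 addr0 sub0r.
rewrite ltNge ltW//= mulr0 mul0r oppr0.
apply: (@near_eq_is_derive _ _ _ (cst (0 : R))).
near=> s; rewrite /costate max_l// subr_le0 ltW//; near: s.
exact: cvgr_gt cgH _ Ht.
Unshelve. all: by end_near. Qed.

Lemma is_derive_costate_ae : {ae mu, forall t, t \in `]0, T[ ->
  is_derive t (1 : R) costate (- (gamma * active t * F t))}.
Proof.
have dH := is_derive_integral_ae _ _ _
  (bounded_measurable_integrable bounded_measurable_Ffun).
(* As [H] is strictly increasing on [[0, T]] and [gamma > 0], the kink is met at most once. *)
have dN : {ae mu, forall t, t \in `]0, T[ -> gamma * H t != lambda}.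
  have [[t0 [t0T Ht0]]|noN] :=
    pselect (exists t0, (t0 \in `]0, T[) /\ (gamma * H t0 = lambda)); last first.
    by apply: aeW => t tT; apply/eqP => Ht; apply: noN; exists t.
  exists [set t0]; split => //; first exact: lebesgue_measure_set1.
  move=> t /= /not_implyP[tT /negP/negPn/eqP Ht].
  have HH : H t = H t0.
    by apply: (@mulfI _ gamma); [rewrite gt_eqF// (lt_le_trans _ gamma_ge1)|rewrite Ht].
  move: tT t0T; rewrite !in_itv/= => /andP[t_gt0 tT] /andP[t0_gt0 t0T].
  case: (ltgtP t t0) => // tt0.
    by have := ltr_Hfun _ _ (ltW t_gt0) tt0 (ltW t0T); rewrite HH ltxx.
  by have := ltr_Hfun _ _ (ltW t0_gt0) tt0 (ltW tT); rewrite HH ltxx.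
apply: (lebesgue_aeS2 _ _ _ _ dH dN) => t Ht tl t0T.
by apply: is_derive_costate; [exact: Ht|exact: tl].
Qed.

Lemma bounded_measurable_active : bounded_measurable 0 T active.
Proof.
split; last by exists 1 => t _; rewrite /active; case: ifP; rewrite ?normr0 ?normr1.
apply: measurable_fun_if => //; apply: measurable_fun_ltr => //.
apply: measurable_funM => //.
by have [] := abs_continuous_bounded_measurable abs_continuous_Hfun.
Qed.

Lemma bounded_measurable_costate : bounded_measurable 0 T costate.
Proof. exact: abs_continuous_bounded_measurable abs_continuous_costate. Qed.

Lemma Hfun0 : H 0 = 0.
Proof. by rewrite /Hfun set_itv1 Rintegral_set1. Qed.

Lemma Hfun_ge0 t : 0 <= H t.
Proof. by apply: Rintegral_ge0 => s _; rewrite ltW// Ffun_gt0. Qed.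

(** [phi] is the derivative of [costate * y / F], which runs from [lambda * alpha] at 0 to 0 at [T];
    hence its integral is the same for every admissible pair. *)
Lemma costate_identity alpha u y : feasible f g alpha T u y ->
  let phi t := g t / F t * costate t * u t + - (gamma * active t) * y t in
  mu.-integrable `[0, T] (EFin \o phi) /\
  \int[mu]_(t in `[0, T]) phi t = - (lambda * alpha).
Proof.
move=> [u2 [acy y0 dy] yT] phi.
have iphi : mu.-integrable `[0, T] (EFin \o phi).
  apply: integrable_addr.
    apply: (integrable_bounded_measurableM _ (L2_integrable u u2)).
    exact: bounded_measurableM bounded_measurable_gF bounded_measurable_costate.
  apply: (integrable_bounded_measurableM (h := fun t => - (gamma * active t))).
    under eq_fun do rewrite -mulNr.
    exact: bounded_measurableM (bounded_measurable_cst _ _ _) bounded_measurable_active.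
  exact: bounded_measurable_integrable (abs_continuous_bounded_measurable acy).
split => //.
have acw := abs_continuousM abs_continuous_costate
  (abs_continuousM acy abs_continuous_invFfun).
have dyF : {ae mu, forall t, t \in `]0, T[ ->
    is_derive t (1 : R) (fun s => y s / F s) (g t / F t * u t)}.
  apply: (lebesgue_aeS2 _ _ _ _ is_derive_Ffun_ae dy) => s Fs ys s0T.
  by apply: is_derive_div_Ffun; [exact: Fs|exact: ys].
have dw : {ae mu, forall t, t \in `]0, T[ ->
    is_derive t (1 : R) (fun s => costate s * (y s / F s)) (phi t)}.
  apply: (lebesgue_aeS2 _ _ _ _ is_derive_costate_ae dyF) => t ct yt t0T.
  apply: (is_derive_eq (is_deriveM (ct t0T) (yt t0T))).
  rewrite -![_ *: _]/(_ * _) /phi; field.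
  exact/lt0r_neq0/Ffun_gt0.
have T0T : T \in `[0, T] by rewrite in_itv/= lexx ltW.
have := abs_continuous_FTC _ _ _ _ acw iphi dw _ T0T.
(* [costate 0 = lambda] because [H 0 = 0] and [lambda > 0]. *)
rewrite yT mul0r mulr0 Ffun0 divr1 y0 /costate Hfun0 mulr0 subr0 max_r ?ltW//.
by move=> /esym/eqP; rewrite addrC addr_eq0 => /eqP.
Qed.

(** * The candidate control and its state *)

Local Notation uh := (uhat f g gamma lambda).

Lemma gF_gt0 t : 0 <= t -> 0 < g t / F t.
Proof. by move=> t0; rewrite divr_gt0 ?g_gt0 ?Ffun_gt0. Qed.

(** Exhibits [uhat] as a soft threshold. Cutting the costate off at 0 changes nothing: where
    [lambda < gamma * H t], both sides are 0. *)
Lemma uhat_costate t : 0 <= t -> uh t = Num.max 0 (g t / F t * costate t - 1).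
Proof.
move=> t0; have G0 := gF_gt0 t t0; rewrite /uhat /costate.
have -> : -1 - gamma * (g t * H t / F t) + lambda * (g t / F t) =
  g t / F t * (lambda - gamma * H t) - 1 by ring.
have [p0|p0] := leP 0 (lambda - gamma * H t) => //.
rewrite mulr0 sub0r !max_l ?lerN10// subr_le0 (le_trans _ ler01)//.
by rewrite pmulr_rle0// ltW.
Qed.

Lemma uhat_ge0 t : 0 <= uh t. Proof. by rewrite le_max lexx. Qed.

Lemma bounded_measurable_uhat : bounded_measurable 0 T uh.
Proof.
have bG := bounded_measurable_gF.
have bH := abs_continuous_bounded_measurable abs_continuous_Hfun.
have cM (c : R) h : bounded_measurable 0 T h -> bounded_measurable 0 T (fun t => c * h t).
  exact: bounded_measurableM (bounded_measurable_cst _ _ _).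
apply: bounded_measurable_max0; apply: bounded_measurableD; last exact: cM.
apply: bounded_measurableD; first exact: bounded_measurable_cst.
under eq_fun do rewrite mulrAC -mulNr.
exact/cM/bounded_measurableM.
Qed.

Lemma L2_uhat : L2 T uh.
Proof. exact/bounded_measurable_L2/bounded_measurable_uhat. Qed.

Definition yhat alpha t :=
  F t * (alpha + \int[mu]_(tau in `[0, t]) (g tau / F tau * uh tau)).

Context {alpha : R}.
Context (lambdaP : \int[mu]_(tau in `[0, T]) (uh tau * (g tau / F tau)) = - alpha).

Lemma feasible_uhat : feasible f g alpha T uh (yhat alpha).
Proof.
split; first exact: L2_uhat.
  by apply/state_formula => //; exact: L2_uhat.
rewrite /yhat.
have -> : \int[mu]_(tau in `[0, T]) (g tau / F tau * uh tau) = - alpha.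
  by rewrite -lambdaP; apply: eq_Rintegral => t _; rewrite mulrC.
by rewrite subrr mulr0.
Qed.

(** The equation defining [lambda] trades the integral up to [t] for one over the remaining time,
    from which the sign of the state is read off. *)
Lemma yhat_tail t : t \in `[0, T] ->
  yhat alpha t = - F t * \int[mu]_(tau in `]t, T[) (g tau / F tau * uh tau).
Proof.
rewrite in_itv/= => /andP[t0 tT].
have iGu := integrable_gF_control uh L2_uhat.
rewrite -(Rintegral_itv_sub _ _ _ _ iGu t0 tT).
have -> : \int[mu]_(tau in `[0, T]) (g tau / F tau * uh tau) = - alpha.
  by rewrite -lambdaP; apply: eq_Rintegral => s _; rewrite mulrC.
rewrite /yhat; ring.
Qed.

(** Complementarity: while [gamma * H t < lambda], the tail formula makes the state nonpositive;
    afterwards [uhat] vanishes on []t, T[], so the state is 0. *)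
Lemma yhat_active t : t \in `[0, T] ->
  gamma * `|yhat alpha t| = - (gamma * active t * yhat alpha t).
Proof.
move=> t0T; have F0 := Ffun_gt0 t.
have := t0T; rewrite in_itv/= => /andP[t0 tT].
rewrite /active yhat_tail//; case: ltP => Ht.
  rewrite mulr1 ler0_norm; first by ring.
  rewrite mulNr oppr_le0 mulr_ge0 ?(ltW F0)//.
  apply: Rintegral_ge0 => s /=; rewrite in_itv/= => /andP[ts _].
  by rewrite mulr_ge0 ?uhat_ge0// ltW// gF_gt0// (le_trans t0)// ltW.
rewrite (_ : \int[mu]_(tau in `]t, T[) (g tau / F tau * uh tau) = 0).
  by rewrite !mulr0 normr0 mulr0 oppr0.
transitivity (\int[mu]_(_ in `]t, T[) (0 : R)); last by rewrite Rintegral_cst ?mul0r.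
apply: eq_Rintegral => s; rewrite inE/= in_itv/= => /andP[ts sT].
have s0 : 0 <= s by rewrite (le_trans t0)// ltW.
have Hs := ltr_Hfun _ _ t0 ts (ltW sT).
rewrite uhat_costate// /costate [Num.max 0 (_ - _ * _)]max_l.
  by rewrite mulr0 sub0r max_l ?mulr0// lerN10.
by rewrite subr_le0 (le_trans Ht)// ler_pM2l ?ltW// (lt_le_trans _ gamma_ge1).
Qed.

(** * Quadratic growth of the cost and uniqueness *)

Lemma integrable_sqr_uhatB v : L2 T v ->
  mu.-integrable `[0, T] (EFin \o (fun t => 2^-1 * (v t - uh t) ^+ 2)).
Proof.
move=> v2; have bu := bounded_measurable_uhat.
apply: (integrable_bounded_measurableM (bounded_measurable_cst _ _ _)).
have -> : (fun t => (v t - uh t) ^+ 2) =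
    (fun t => v t ^+ 2 + (-2 * uh t) * v t + uh t * uh t).
  by apply/funext => t; ring.
apply: integrable_addr; first apply: integrable_addr.
- exact: L2_integrable_sqr.
- apply: (integrable_bounded_measurableM _ (L2_integrable v v2)).
  exact: bounded_measurableM (bounded_measurable_cst _ _ _) bu.
- exact: bounded_measurable_integrable (bounded_measurableM bu bu).
Qed.

Lemma cost_quadratic_growth v z : feasible f g alpha T v z ->
  (cost gamma T uh (yhat alpha) +
   (\int[mu]_(t in `[0, T]) (2^-1 * (v t - uh t) ^+ 2))%:E <= cost gamma T v z)%E.
Proof.
move=> vz; have [v2 [acz _ _] _] := vz.
have [u2 [acy _ _] _] := feasible_uhat.
have [iv vE] := costate_identity _ _ _ vz.
have [iu uE] := costate_identity _ _ _ feasible_uhat.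
rewrite !cost_running_cost//.
have jv := integrable_running_cost gamma _ _ v2 acz.
have ju := integrable_running_cost gamma _ _ u2 acy.
have iq : mu.-integrable `[0, T] (EFin \o (fun t => 2^-1 * (v t - uh t) ^+ 2)).
  exact: integrable_sqr_uhatB.
(* The common dual constant is added to both sides, written as the integral for [v] on the left and
   for [uhat] on the right; the inequality then holds pointwise. *)
rewrite -EFinD lee_fin -(lerD2r (- (lambda * alpha))) -[in leLHS]vE -uE.
have iuq := integrable_addr ju iq.
rewrite -(Rintegral_addr ju iq) -(Rintegral_addr iuq iv) -(Rintegral_addr jv iu).
apply: (le_Rintegral _ (integrable_addr iuq iv) (integrable_addr jv iu)) => //.
move=> t; rewrite /= in_itv/= => t0T; have t0 : 0 <= t by case/andP: t0T.
(* By complementarity the state cost of [yhat] on the left equals its dual term on the right. *)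
rewrite /running_cost yhat_active ?in_itv//.
have c0 : 0 <= g t / F t * costate t.
  by rewrite mulr_ge0 ?(ltW (gF_gt0 t t0))// /costate le_max lexx.
have := soft_threshold_min (v t) _ c0; rewrite -uhat_costate//.
have : - (gamma * active t) * z t <= gamma * `|z t|.
  have g0 : 0 <= gamma by exact: le_trans gamma_ge1.
  rewrite mulNr -mulrN -mulrA ler_wpM2l// /active; case: ifP => _.
    by rewrite mul1r -normrN ler_norm.
  by rewrite mul0r.
lra.
Qed.

Lemma optimal_uhat : optimal_control f g gamma alpha T uh.
Proof.
exists (yhat alpha); split; first exact: feasible_uhat.
move=> v z vz; apply: le_trans (cost_quadratic_growth v z vz).
rewrite leeDl// lee_fin; apply: Rintegral_ge0 => t _.
by rewrite mulr_ge0 ?sqr_ge0.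
Qed.

(** An optimal control costs no more than [uhat], so the quadratic growth term has integral 0 and
    its integrand vanishes almost everywhere. *)
Lemma optimal_unique u : optimal_control f g gamma alpha T u ->
  ae_eq mu `]0, T[%classic u uh.
Proof.
move=> [y [uy /(_ _ _ feasible_uhat) uyle]].
have [u2 _ _] := uy.
have [uh2 [acy _ _] _] := feasible_uhat.
have iq := integrable_sqr_uhatB u u2.
have := le_trans (cost_quadratic_growth u y uy) uyle.
rewrite cost_running_cost// -EFinD lee_fin gerDl => q_le0.
have q0 : \int[mu]_(t in `[0, T]) (2^-1 * (u t - uh t) ^+ 2) = 0.
  apply/eqP; rewrite eq_le q_le0/=; apply: Rintegral_ge0 => t _.
  by rewrite mulr_ge0 ?sqr_ge0.
have mq := measurable_int _ iq.
have : (\int[mu]_(t in `[0%R, T]) `|(EFin \o (fun t => 2^-1 * (u t - uh t) ^+ 2)%R) t| = 0)%E.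
  transitivity (\int[mu]_(t in `[0%R, T]) (2^-1 * (u t - uh t) ^+ 2)%R%:E)%E.
    by apply: eq_integral => t _ /=; rewrite ger0_norm// mulr_ge0 ?sqr_ge0.
  by rewrite -[LHS]fineK; [rewrite -[X in X%:E]/(Rintegral _ _ _) q0|exact: integrable_fin_num].
move=> /(ae_eq_integral_abs mu (measurable_itv _) mq) => h.
apply: (lebesgue_aeS2 _ _ _ _ h h) => t /= ut _ t0T.
have /ut : t \in `[0, T] by exact: subset_itv_oo_cc.
move=> [] /eqP; rewrite mulf_eq0 invr_eq0 pnatr_eq0/= sqrf_eq0 subr_eq0.
by move=> /eqP.
Qed.

End Costate.

(** * Existence of the multiplier *)

(** [g] attains a positive minimum on [[0, T]] and [F] is bounded there; this makes the integral of
    [(g / F) ^+ 2] positive. *)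
Lemma gF_bounded_below : exists2 d, 0 < d & forall t, t \in `[0, T] -> d <= g t / F t.
Proof.
have cgT : {within `[0, T], continuous g}.
  by apply: continuous_subspaceW cg; exact: subset_itvl.
have [c c0T gc] := EVT_min (ltW T_gt0) cgT.
have [M M0 FM] := abs_continuous_bounded abs_continuous_Ffun.
have gc0 : 0 < g c by apply: g_gt0; move: c0T; rewrite in_itv => /andP[].
exists (g c / (M + 1)); first by rewrite divr_gt0// ltr_wpDl.
move=> t t0T; have g0 : 0 < g t by exact: lt_le_trans (gc t t0T).
apply: ler_pM; [exact: ltW|by rewrite invr_ge0 addr_ge0|exact: gc|].
rewrite lef_pV2 ?posrE ?ltr_wpDl ?Ffun_gt0//.
by rewrite (le_trans (ler_norm _))// (le_trans (FM t _))// lerDl.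
Qed.

(** Intermediate value theorem for [Phi], the integral as a function of the multiplier: it is
    Lipschitz, vanishes at 0 and grows at least linearly. *)
Lemma exists_multiplier (gamma alpha : R) : 1 <= gamma -> alpha < 0 ->
  exists2 lambda : R, 0 < lambda &
    \int[mu]_(tau in `[0, T]) (uhat f g gamma lambda tau * (g tau / F tau)) = - alpha.
Proof.
move=> gamma_ge1 alpha_lt0.
pose G t := g t / F t.
pose Phi l := \int[mu]_(tau in `[0, T]) (uhat f g gamma l tau * G tau).
have bG : bounded_measurable 0 T G := bounded_measurable_gF.
have iPhi l : mu.-integrable `[0, T] (EFin \o (fun t => uhat f g gamma l t * G t)).
  apply/bounded_measurable_integrable/(bounded_measurableM _ bG).
  exact: bounded_measurable_uhat.
have iG2 := bounded_measurable_integrable (bounded_measurableM bG bG).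
pose S := \int[mu]_(t in `[0, T]) (G t * G t).
have G_ge0 t : t \in `[0, T] -> 0 <= G t.
  by rewrite in_itv/= => /andP[t0 _]; exact/ltW/gF_gt0.
have S_gt0 : 0 < S.
  have [d d0 dG] := gF_bounded_below.
  have idd := bounded_measurable_integrable (bounded_measurable_cst 0 T (d * d)).
  apply: (@lt_le_trans _ _ (\int[mu]_(_ in `[0, T]) (d * d))).
    rewrite Rintegral_cst//= [X in fine X]lebesgue_measure_itv/= lte_fin T_gt0/= subr0.
    by rewrite !mulr_gt0.
  apply: (le_Rintegral _ idd iG2) => // t /= tT.
  by apply: ler_pM; [exact: ltW|exact: ltW|exact: dG|exact: dG].
(* The positive part is 1-Lipschitz and its argument is affine in [l] with slope [G t]; integration
   against [G] gives the constant [S]. *)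
have lipPhi l l' : `|Phi l' - Phi l| <= S * `|l' - l|.
  rewrite /Phi -RintegralB//.
  have iS : mu.-integrable `[0, T] (EFin \o (fun t => `|l' - l| * (G t * G t))).
    exact: integrable_bounded_measurableM (bounded_measurable_cst _ _ _) iG2.
  have iPB : mu.-integrable `[0, T] (EFin \o (fun t =>
      uhat f g gamma l' t * G t - uhat f g gamma l t * G t)).
    apply: integrable_addr => //.
    have := integrable_bounded_measurableM (bounded_measurable_cst 0 T (-1)) (iPhi l).
    by apply: eq_integrable => // t _ /=; rewrite mulN1r.
  apply: (le_trans (le_normr_Rintegral _ iPB)) => //.
  rewrite mulrC -RintegralZl//.
  apply: (le_Rintegral _ (integrable_norm iPB) iS) => // t /= tT.
  rewrite -mulrBl normrM (ger0_norm (G_ge0 t tT)) (mulrA `|l' - l|) ler_wpM2r ?G_ge0//.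
  apply: (le_trans (max0_lipschitz _ _)).
  rewrite -/(G t) opprD addrACA subrr add0r -mulrBl normrM.
  by rewrite (ger0_norm (G_ge0 t tT)).
(* Absolute continuity is the route from the Lipschitz bound to continuity of [Phi] on [[0, L]]. *)
have acPhi L : abs_continuous 0 L Phi.
  have acid : abs_continuous 0 L (@id R).
    move=> e e0; exists e => // n l r lr _; apply: le_lt_trans.
    by apply: ler_sum => i _; have [_ ? _] := lr i; rewrite ger0_norm ?subr_ge0.
  apply: (abs_continuous_le S id id) => //.
  move=> s t _ _ _; rewrite (le_trans (lipPhi _ _))// ler_pM2l//.
    by rewrite lerDl.
(* At [l = 0] the second argument of the maximum is at most -1. *)
have Phi0 : Phi 0 = 0.
  transitivity (\int[mu]_(_ in `[0, T]) (0 : R)); last by rewrite Rintegral_cst ?mul0r.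
  apply: eq_Rintegral => t; rewrite inE => tT; rewrite /uhat mul0r addr0 max_l ?mul0r//.
  rewrite mulrAC subr_le0 (le_trans (lerN10 _))// mulr_ge0 ?(le_trans ler01 gamma_ge1)//.
  by rewrite mulr_ge0 ?Hfun_ge0// G_ge0.
(* [K] collects the terms free of [l] when the maximum in [uhat] is bounded below by its second
   argument, giving [Phi l >= l * S - K]. *)
pose K := \int[mu]_(t in `[0, T]) ((1 + gamma * (G t * H t)) * G t).
have bK : bounded_measurable 0 T (fun t => (1 + gamma * (G t * H t)) * G t).
  have bH := abs_continuous_bounded_measurable abs_continuous_Hfun.
  apply/bounded_measurableM/bG/bounded_measurableD; first exact: bounded_measurable_cst.
  apply/bounded_measurableM; first exact: bounded_measurable_cst.
  exact: bounded_measurableM.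
have iK := bounded_measurable_integrable bK.
have PhiL l : l * S <= Phi l + K.
  have iS : mu.-integrable `[0, T] (EFin \o (fun t => l * (G t * G t))).
    exact: integrable_bounded_measurableM (bounded_measurable_cst _ _ _) iG2.
  rewrite -RintegralZl// -Rintegral_addr//.
  apply: (le_Rintegral _ iS (integrable_addr (iPhi l) iK)) => // t /= tT.
  rewrite -mulrDl (mulrA l) ler_wpM2r ?G_ge0// -lerBlDr le_max; apply/orP; right.
  rewrite le_eqVlt; apply/orP; left; apply/eqP; rewrite -/(G t) mulrAC -/(G t).
  ring.
(* [L] solves [L * S - K = - alpha], so [Phi] has reached the target value there. *)
pose L := (K - alpha) / S.
have PhiLa : - alpha <= Phi L.
  by have := PhiL L; rewrite /L divfK ?gt_eqF//; lra.
have K_ge0 : 0 <= K.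
  apply: Rintegral_ge0 => t tT; have gamma_ge0 : 0 <= gamma by exact: le_trans gamma_ge1.
  apply: mulr_ge0; last exact: G_ge0.
  by rewrite addr_ge0// mulr_ge0// mulr_ge0 ?Hfun_ge0 ?G_ge0.
have L0 : 0 <= L by apply: divr_ge0; [lra|exact: ltW].
have [c c0L Phic] : exists2 c, c \in `[0, L] & Phi c = - alpha.
  apply: IVT => //; first exact: abs_continuous_within (acPhi L).
  by rewrite Phi0 ge_min le_max PhiLa; lra.
(* [c = 0] is excluded by [Phi 0 = 0 < - alpha]. *)
exists c => //; rewrite lt_neqAle; apply/andP; split.
  by apply/eqP => c0; move: Phic; rewrite -c0 Phi0; lra.
by move: c0L; rewrite in_itv => /andP[].
Qed.

End ControlSystem.

Theorem theorem1 (R : realType) (f g : R -> R) (gamma alpha T : R)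
  (cf : {within `[0, +oo[, continuous f})
  (cg : {within `[0, +oo[, continuous g})
  (f_gt0 : forall t : R, 0 <= t -> 0 < f t)
  (g_gt0 : forall t : R, 0 <= t -> 0 < g t)
  (gamma_ge1 : 1 <= gamma) (alpha_lt0 : alpha < 0) (T_gt0 : 0 < T) :
  [/\ forall u : R -> R, L2 T u -> forall y : R -> R,
        state f g alpha T u y <->
        (forall t : R, t \in `[0, T] ->
           y t = Ffun f t * (alpha +
             \int[lebesgue_measure]_(tau in `[0, t])
                (g tau / Ffun f tau * u tau))),
      exists2 lambda : R, 0 < lambda &
        \int[lebesgue_measure]_(tau in `[0, T])
           (uhat f g gamma lambda tau * (g tau / Ffun f tau)) = - alpha &
      forall lambda : R, 0 < lambda ->
        \int[lebesgue_measure]_(tau in `[0, T])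
           (uhat f g gamma lambda tau * (g tau / Ffun f tau)) = - alpha ->
        optimal_control f g gamma alpha T (uhat f g gamma lambda) /\
        (forall u : R -> R, optimal_control f g gamma alpha T u ->
           ae_eq (@lebesgue_measure R) `]0, T[%classic u (uhat f g gamma lambda))].
Proof.
split=> [u u2 y||lambda lambda_gt0 lambdaP].
- exact: state_formula.
- exact: exists_multiplier.
- split; first exact: optimal_uhat.
  by move=> u; exact: optimal_unique.
Qed.
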